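(* Let $0<\alpha,\beta<1$ and $\tau>0$. With $G(\zeta)=-\gamma_1\zeta-\gamma_0$, where $\gamma_0=-\frac{2-\alpha}{2-2\alpha}$ and $\gamma_1=\frac{\alpha}{2-2\alpha}$, the generating function $w(\zeta)=\Big(1+\big(\frac{1-\zeta}{\tau}\big)^\alpha G(\zeta)^{1-\alpha}\Big)^{-\beta}$ takes the form $$w(\zeta)=\bigg[1+\Big(\frac{1-\zeta}{\tau}\Big)^\alpha\Big(\frac{2-\alpha}{2-2\alpha}\Big)^{1-\alpha}\Big(1-\frac{\alpha}{2-\alpha}\zeta\Big)^{1-\alpha}\bigg]^{-\beta},$$ and $w$ is analytic and nonnegative on $(-\infty,1)$.
   Context: Complex powers are taken with the principal branch. *)

(* Defs.v *)
From Stdlib Require Import Reals.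
From Coquelicot Require Import Coquelicot.

Local Open Scope R_scope.

(* Principal argument, with values in (-PI, PI]; its value at 0 is irrelevant. *)
Definition Carg (z : C) : R :=
  if Rle_dec 0 (Im z) then acos (Re z / Cmod z) else - acos (Re z / Cmod z).

Definition Cexp (z : C) : C := (exp (Re z) * cos (Im z), exp (Re z) * sin (Im z)).

Definition Clog (z : C) : C := (ln (Cmod z), Carg z).

(* Principal branch of z ^ a, with the usual conventions 0 ^ 0 = 1 and
   0 ^ a = 0 for a <> 0. *)
Definition Cpower (z a : C) : C :=
  if Ceq_dec z 0 then (if Ceq_dec a 0 then RtoC 1 else RtoC 0)
  else Cexp (a * Clog z)%C.

Definition analytic_at (f : C -> C) (z0 : C) : Prop :=
  exists (a : nat -> C) (r : R), 0 < r /\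
    forall z : C, Cmod (z - z0)%C < r ->
      @is_pseries C_AbsRing C_NormedModule a (z - z0)%C (f z).

Definition gamma0 (alpha : R) : R := - ((2 - alpha) / (2 - 2 * alpha)).

Definition gamma1 (alpha : R) : R := alpha / (2 - 2 * alpha).

Definition G (alpha : R) (zeta : C) : C :=
  (- gamma1 alpha * zeta - gamma0 alpha)%C.

Definition w (alpha beta tau : R) (zeta : C) : C :=
  Cpower (1 + Cpower ((1 - zeta) / tau) alpha
              * Cpower (G alpha zeta) (1 - alpha))%C
         (- beta)%C.

(* Main.v *)
Require Import Defs.
From Stdlib Require Import Reals Factorial Lra Lia ClassicalEpsilon.
From Coquelicot Require Import Coquelicot.

(** The factorisation of [w] holds because [G zeta] is the positive real
    [(2 - alpha) / (2 - 2 alpha)] times [1 - alpha / (2 - alpha) * zeta], and a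
    positive real factor does not change the principal argument: it can be
    taken out of a principal power ([Cpower_pos_mult]).

    For real [x < 1] the bases [(1 - x) / tau] and [G x] are positive reals,
    hence so is [1 + ((1 - x) / tau) ^ alpha * G x ^ (1 - alpha)], and its power
    of exponent [- beta] is a positive real.

    For analyticity at such an [x], the function is built from affine functions
    by products, adding 1, and three principal powers whose base takes a
    positive real value at [x].  It is therefore enough that power series
    expansions are stable under these operations.  Expansions are measured by
    the weighted l1 norm of their coefficients: in this Banach algebra an
    absolutely convergent series of expansions is an expansion
    ([expansion_series], by exchanging a double sum), which gives products
    ([expansion_mult]) and substitution into a power series
    ([expansion_compose]).  A principal power with positive base value [p] is
    [p ^ a * (1 + h) ^ a] with [h] vanishing at the centre
    ([analytic_germ_Cpower]), so only the binomial series of [(1 + u) ^ a] for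
    small complex [u] is needed.  That comes from real analysis
    ([binomial_series]): along the segment from 1 to [1 + u], the real function
    [Re (c * (1 + t u) ^ a)] has explicit derivatives of all orders, and its
    Lagrange remainder tends to 0. *)

Local Open Scope R_scope.

(** * Convergence of complex series and exchange of summations *)

(** Equations between finite sums are typed at the carrier of an abelian
    monoid; [ring] and [field] want them at [C] or [R]. *)
Ltac eq_at_carrier :=
  match goal with |- @eq _ ?x ?y =>
    first [change (@eq C x y) | change (@eq R x y)] end.

(** Convergence of a complex series, encoded as a real limit so that all
    estimates below are estimates of real sequences. *)
Definition Csums (s : nat -> C) (T : C) : Prop :=
  is_lim_seq (fun N => Cmod (sum_n s N - T)%C) 0.

Lemma sum_n_S_R (a : nat -> R) n : sum_n a (S n) = sum_n a n + a (S n).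
Proof. exact (sum_Sn a n). Qed.

Lemma sum_n_S_C (a : nat -> C) n : sum_n a (S n) = (sum_n a n + a (S n))%C.
Proof. exact (sum_Sn a n). Qed.

Lemma sum_n_le_R (a b : nat -> R) n :
  (forall k, a k <= b k) -> sum_n a n <= sum_n b n.
Proof.
  intros H; induction n as [|n IH].
  - rewrite !sum_O; apply H.
  - rewrite !sum_n_S_R; specialize (H (S n)); lra.
Qed.

Lemma sum_n_ge0 (a : nat -> R) n : (forall k, 0 <= a k) -> 0 <= sum_n a n.
Proof.
  intros H; induction n as [|n IH].
  - rewrite sum_O; apply H.
  - rewrite sum_n_S_R; specialize (H (S n)); lra.
Qed.

Lemma sum_n_scal_R (c : R) (a : nat -> R) n :
  sum_n (fun k => c * a k) n = c * sum_n a n.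
Proof. exact (sum_n_mult_l c a n). Qed.

Lemma sum_n_scal_C (c : C) (a : nat -> C) n :
  sum_n (fun k => c * a k)%C n = (c * sum_n a n)%C.
Proof. exact (sum_n_mult_l (K := C_Ring) c a n). Qed.

Lemma sum_n_term_le (a : nat -> R) n : (forall k, 0 <= a k) -> a n <= sum_n a n.
Proof.
  intros H; destruct n as [|n].
  - rewrite sum_O; lra.
  - rewrite sum_n_S_R; generalize (sum_n_ge0 a n H); lra.
Qed.

Lemma Cmod_sum_n_le (s : nat -> C) n :
  Cmod (sum_n s n) <= sum_n (fun k => Cmod (s k)) n.
Proof.
  induction n as [|n IH].
  - rewrite !sum_O; lra.
  - rewrite sum_n_S_R, sum_n_S_C.
    eapply Rle_trans; [apply Cmod_triangle|]; lra.
Qed.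

Lemma nonneg_series_bounded (a : nat -> R) (M : R) :
  (forall n, 0 <= a n) -> (forall N, sum_n a N <= M) ->
  ex_series a /\ Series a <= M.
Proof.
  intros H0 HM.
  assert (Hl : ex_finite_lim_seq (sum_n a)).
  { apply ex_finite_lim_seq_incr with M; [|exact HM].
    intros n; rewrite sum_n_S_R; specialize (H0 (S n)); lra. }
  destruct Hl as [l Hl].
  assert (Hs : is_series a l) by exact Hl.
  split; [exists l; exact Hs|].
  rewrite (is_series_unique _ _ Hs).
  exact (is_lim_seq_le _ _ l M HM Hl (is_lim_seq_const M)).
Qed.

Lemma sum_n_le_Series (a : nat -> R) (N : nat) :
  (forall n, 0 <= a n) -> ex_series a -> sum_n a N <= Series a.
Proof.
  intros H0 Hex.
  apply (is_lim_seq_incr_compare (sum_n a) (Series a)).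
  - exact (Series_correct a Hex).
  - intros n; rewrite sum_n_S_R; specialize (H0 (S n)); lra.
Qed.

Lemma Csums_ext (s t : nat -> C) (T : C) :
  (forall n, s n = t n) -> Csums s T -> Csums t T.
Proof.
  intros H Hs; unfold Csums; eapply is_lim_seq_ext; [|exact Hs].
  intros n; cbv beta; now rewrite (sum_n_ext s t n H).
Qed.

Lemma is_lim_seq_squeeze0 (u v : nat -> R) :
  (forall n, 0 <= u n <= v n) -> is_lim_seq v 0 -> is_lim_seq u 0.
Proof.
  intros H Hv.
  exact (is_lim_seq_le_le (fun _ => 0) u v 0 H (is_lim_seq_const 0) Hv).
Qed.

Lemma Csums_scal (c : C) (s : nat -> C) (T : C) :
  Csums s T -> Csums (fun n => c * s n)%C (c * T)%C.
Proof.
  intros Hs; unfold Csums.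
  apply is_lim_seq_ext with (fun N => Cmod c * Cmod (sum_n s N - T)).
  { intros n; rewrite sum_n_scal_C, <- Cmod_mult; f_equal; ring. }
  replace (Finite 0) with (Rbar_mult (Cmod c) 0) by (simpl; f_equal; ring).
  apply is_lim_seq_scal_l, Hs.
Qed.

Lemma Csums_plus (s t : nat -> C) (S T : C) :
  Csums s S -> Csums t T -> Csums (fun n => s n + t n)%C (S + T)%C.
Proof.
  intros Hs Ht.
  apply is_lim_seq_squeeze0
    with (fun N => Cmod (sum_n s N - S) + Cmod (sum_n t N - T)).
  - intros n; split; [apply Cmod_ge_0|].
    replace (sum_n (fun n => s n + t n)%C n) with (sum_n s n + sum_n t n)%C
      by (symmetry; exact (sum_n_plus s t n)).
    eapply Rle_trans; [|apply Cmod_triangle]; right; f_equal; ring.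
  - replace (Finite 0) with (Finite (0 + 0)) by (f_equal; ring).
    now apply is_lim_seq_plus'.
Qed.

Lemma Csums_minus (s t : nat -> C) (S T : C) :
  Csums s S -> Csums t T -> Csums (fun n => s n - t n)%C (S - T)%C.
Proof.
  intros Hs Ht.
  replace (S - T)%C with (S + (-1) * T)%C by ring.
  apply Csums_ext with (fun n => s n + (-1) * t n)%C; [intros n; ring|].
  now apply Csums_plus, Csums_scal.
Qed.

Lemma Csums_sum_n (d : nat -> nat -> C) (s : nat -> C) (N : nat) :
  (forall n, Csums (fun k => d k n) (s n)) ->
  Csums (fun k => sum_n (d k) N) (sum_n s N).
Proof.
  intros H; induction N as [|N IH].
  - rewrite sum_O; apply Csums_ext with (fun k => d k 0%nat); [|apply H].
    intros n; now rewrite sum_O.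
  - rewrite sum_n_S_C.
    apply Csums_ext with (fun k => sum_n (d k) N + d k (S N))%C.
    + intros n; now rewrite sum_n_S_C.
    + now apply Csums_plus.
Qed.

Lemma Csums_shift (s : nat -> C) (T : C) :
  Csums s T -> Csums (fun n => match n with 0%nat => RtoC 0 | S m => s m end) T.
Proof.
  intros H; apply is_lim_seq_incr_1.
  eapply is_lim_seq_ext; [|exact H].
  intros n; simpl; do 2 f_equal.
  induction n as [|n IH].
  - rewrite sum_n_S_C, !sum_O; eq_at_carrier; ring.
  - rewrite (sum_n_S_C _ (S n)), <- IH, sum_n_S_C; reflexivity.
Qed.

Lemma Csums_Cmod_le (s : nat -> C) (T : C) (M : R) :
  Csums s T -> (forall N, Cmod (sum_n s N) <= M) -> Cmod T <= M.
Proof.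
  intros Hs HM.
  assert (H : is_lim_seq (fun N => M + Cmod (sum_n s N - T)) (M + 0))
    by (apply is_lim_seq_plus'; [apply is_lim_seq_const|exact Hs]).
  rewrite Rplus_0_r in H.
  refine (is_lim_seq_le _ _ (Cmod T) M _ (is_lim_seq_const _) H).
  intros n; generalize (HM n).
  replace T with (sum_n s n + - (sum_n s n - T))%C at 1 by ring.
  intros; eapply Rle_trans; [apply Cmod_triangle|].
  rewrite Cmod_opp; lra.
Qed.

(** Completeness of the complex numbers in the form used here: real and
    imaginary parts are dominated by the moduli. *)
Lemma Csums_abs (s : nat -> C) (M : R) :
  (forall N, sum_n (fun n => Cmod (s n)) N <= M) -> exists T, Csums s T.
Proof.
  intros HM.
  destruct (nonneg_series_bounded (fun n => Cmod (s n)) M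
              (fun n => Cmod_ge_0 _) HM) as [Hex _].
  assert (HRe : ex_series (fun n => Re (s n)))
    by (apply (ex_series_le (V := R_CompleteNormedModule) _ (fun n => Cmod (s n)));
        [intros n; apply re_le_Cmod|exact Hex]).
  assert (HIm : ex_series (fun n => Im (s n))).
  { apply (ex_series_le (V := R_CompleteNormedModule) _ (fun n => Cmod (s n)));
      [|exact Hex].
    intros n; eapply Rle_trans; [apply Rmax_r|apply Rmax_Cmod]. }
  destruct HRe as [x Hx], HIm as [y Hy].
  exists (x, y).
  assert (Hpair : forall N, sum_n s N =
            (sum_n (fun n => Re (s n)) N, sum_n (fun n => Im (s n)) N)).
  { induction N as [|N IH].
    - rewrite !sum_O; now destruct (s 0%nat).
    - rewrite sum_n_S_C, IH, !sum_n_S_R; reflexivity. }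
  apply is_lim_seq_squeeze0 with (fun N =>
    Rabs (sum_n (fun n => Re (s n)) N - x) + Rabs (sum_n (fun n => Im (s n)) N - y)).
  - intros n; split; [apply Cmod_ge_0|]; rewrite Hpair.
    set (p := sum_n _ n); set (q := sum_n _ n).
    replace ((p, q) - (x, y))%C with (RtoC (p - x) + RtoC (q - y) * Ci)%C
      by (unfold RtoC, Ci, Cplus, Cminus, Cmult, Copp, Cplus; simpl; f_equal; ring).
    eapply Rle_trans; [apply Cmod_triangle|].
    rewrite Cmod_mult, Cmod_Ci, !Cmod_R; lra.
  - replace (Finite 0) with (Finite (0 + 0)) by (f_equal; ring).
    apply is_lim_seq_plus'.
    + replace 0 with (Rabs (x - x)) by (rewrite Rminus_diag, Rabs_R0; reflexivity).
      apply (is_lim_seq_abs _ (x - x)), is_lim_seq_minus';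
        [exact Hx|apply is_lim_seq_const].
    + replace 0 with (Rabs (y - y)) by (rewrite Rminus_diag, Rabs_R0; reflexivity).
      apply (is_lim_seq_abs _ (y - y)), is_lim_seq_minus';
        [exact Hy|apply is_lim_seq_const].
Qed.

Lemma Csums_Cmod_le_Series (s : nat -> C) (T : C) :
  Csums s T -> ex_series (fun n => Cmod (s n)) ->
  Cmod T <= Series (fun n => Cmod (s n)).
Proof.
  intros Hs Hex; apply (Csums_Cmod_le s T _ Hs); intros N.
  eapply Rle_trans; [apply Cmod_sum_n_le|].
  apply sum_n_le_Series; [intros; apply Cmod_ge_0|exact Hex].
Qed.

(** Dominated convergence for series: a fixed tail of [D] controls all the
    tails at once, and the remaining finite sum tends to 0. *)
Lemma tannery (t : nat -> nat -> R) (D : nat -> R) :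
  (forall k N, 0 <= t k N <= D k) -> (forall k, is_lim_seq (t k) 0) ->
  ex_series D -> is_lim_seq (fun N => Series (fun k => t k N)) 0.
Proof.
  intros Ht Hlim HD.
  assert (Hex : forall N, ex_series (fun k => t k N)).
  { intros N; apply (ex_series_le (V := R_CompleteNormedModule) _ D); [|exact HD].
    intros k; destruct (Ht k N) as [H1 H2].
    change (norm (t k N)) with (Rabs (t k N)); rewrite Rabs_pos_eq; lra. }
  assert (Hfin : forall K, is_lim_seq (fun N => sum_n (fun k => t k N) K) 0).
  { induction K as [|K IH].
    - apply is_lim_seq_ext with (t 0%nat); [|apply Hlim].
      intros n; now rewrite sum_O.
    - apply is_lim_seq_ext with (fun N => sum_n (fun k => t k N) K + t (S K) N).
      { intros n; now rewrite sum_n_S_R. }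
      replace (Finite 0) with (Finite (0 + 0)) by (f_equal; ring).
      now apply is_lim_seq_plus'. }
  apply is_lim_seq_spec; intros eps.
  assert (HDl : is_lim_seq (sum_n D) (Series D)) by exact (Series_correct D HD).
  apply is_lim_seq_spec in HDl.
  destruct (HDl (pos_div_2 eps)) as [K HK].
  specialize (HK K (le_n K)); simpl in HK.
  specialize (Hfin K); apply is_lim_seq_spec in Hfin.
  destruct (Hfin (pos_div_2 eps)) as [N0 HN0].
  exists N0; intros N HN; specialize (HN0 N HN); simpl in HN0.
  rewrite Rminus_0_r in HN0 |- *.
  assert (Hp : 0 <= Series (fun k => t k N)).
  { eapply Rle_trans; [|apply (sum_n_le_Series _ 0%nat)];
      [rewrite sum_O; apply Ht|intros; apply Ht|apply Hex]. }
  rewrite Rabs_pos_eq by exact Hp.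
  rewrite (Series_incr_n (fun k => t k N) (S K)) by (try lia; apply Hex).
  rewrite (Series_incr_n D (S K)) in HK by (try lia; exact HD).
  simpl in HK |- *; rewrite <- !sum_n_Reals in *.
  assert (Htail : Series (fun k => t (S (K + k)) N) <= Series (fun k => D (S (K + k)))).
  { apply Series_le; [intros; apply Ht|].
    exact (proj1 (ex_series_incr_n D (S K)) HD). }
  apply Rabs_def2 in HN0; apply Rabs_def2 in HK; lra.
Qed.

(** Fubini for double series.  The difference between the total [T] and the
    first [N] column sums is the sum over the rows of the row tails after [N];
    each of these tends to 0 and is dominated by [D], so [tannery] applies. *)
Lemma Csums_exchange (d : nat -> nat -> C) (D : nat -> R) (S s : nat -> C) (T : C) :
  (forall k N, sum_n (fun n => Cmod (d k n)) N <= D k) -> ex_series D ->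
  (forall k, Csums (d k) (S k)) -> (forall n, Csums (fun k => d k n) (s n)) ->
  Csums S T -> Csums s T.
Proof.
  intros Hd HD Hrow Hcol HT.
  assert (Hpart : forall k N j, Cmod (sum_n (d k) (N + j) - sum_n (d k) N)
            <= sum_n (fun n => Cmod (d k n)) (N + j)
               - sum_n (fun n => Cmod (d k n)) N).
  { intros k N j; induction j as [|j IH].
    - rewrite Nat.add_0_r.
      replace (sum_n (d k) N - sum_n (d k) N)%C with (RtoC 0) by ring.
      rewrite Cmod_0; lra.
    - rewrite Nat.add_succ_r, sum_n_S_C, sum_n_S_R.
      replace (sum_n (d k) (N + j) + d k (Datatypes.S (N + j)) - sum_n (d k) N)%C
        with ((sum_n (d k) (N + j) - sum_n (d k) N) + d k (Datatypes.S (N + j)))%C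
        by ring.
      eapply Rle_trans; [apply Cmod_triangle|]; lra. }
  (* Let j go to infinity in [Hpart]. *)
  assert (Htail : forall k N, Cmod (S k - sum_n (d k) N) <= D k).
  { intros k N.
    assert (H : is_lim_seq (fun j => D k + Cmod (sum_n (d k) (j + N) - S k)) (D k + 0)).
    { apply is_lim_seq_plus'; [apply is_lim_seq_const|].
      apply (is_lim_seq_incr_n (fun j => Cmod (sum_n (d k) j - S k)) N), Hrow. }
    rewrite Rplus_0_r in H.
    refine (is_lim_seq_le _ _ (Cmod (S k - sum_n (d k) N)) (D k) _
              (is_lim_seq_const _) H).
    intros j; rewrite Nat.add_comm.
    replace (S k - sum_n (d k) N)%C with
      ((sum_n (d k) (N + j) - sum_n (d k) N) + - (sum_n (d k) (N + j) - S k))%C by ring.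
    eapply Rle_trans; [apply Cmod_triangle|]; rewrite Cmod_opp.
    generalize (Hpart k N j) (Hd k (N + j)%nat)
      (sum_n_ge0 (fun n => Cmod (d k n)) N (fun n => Cmod_ge_0 _)); lra. }
  apply is_lim_seq_squeeze0
    with (fun N => Series (fun k => Cmod (S k - sum_n (d k) N))).
  - intros N; split; [apply Cmod_ge_0|].
    replace (sum_n s N - T)%C with (- (T - sum_n s N))%C by ring.
    rewrite Cmod_opp.
    apply Csums_Cmod_le_Series.
    + apply Csums_minus; [exact HT|now apply Csums_sum_n].
    + apply (ex_series_le (V := R_CompleteNormedModule) _ D); [|exact HD].
      intros k; change (norm ?x) with (Rabs x).
      rewrite Rabs_pos_eq by apply Cmod_ge_0; apply Htail.
  - apply tannery with D; [|intros k|exact HD].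
    + intros k N; split; [apply Cmod_ge_0|apply Htail].
    + eapply is_lim_seq_ext; [|exact (Hrow k)].
      intros N; rewrite <- Cmod_opp; f_equal; ring.
Qed.

(** * Power series with weighted l1 coefficients *)

(** The number [N] bounds the norm of the coefficients in the l1 space weighted
    by the powers of [r].  This is a Banach algebra norm, and carrying it along
    is what makes substitution of one series into another possible; it also
    bounds [f] on the disc. *)
Definition expansion (r N : R) (f : C -> C) : Prop :=
  exists a : nat -> C,
    (forall m, sum_n (fun n => Cmod (a n) * r ^ n) m <= N) /\
    (forall u, Cmod u <= r -> Csums (fun n => a n * u ^ n)%C (f u)).

Lemma expansion_ext (r N : R) (f g : C -> C) :
  (forall u, Cmod u <= r -> f u = g u) -> expansion r N f -> expansion r N g.
Proof.
  intros H [a [Ha Hs]]; exists a; split; [exact Ha|].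
  intros u Hu; rewrite <- H by exact Hu; auto.
Qed.

Lemma expansion_bound (r N : R) (f : C -> C) (u : C) :
  expansion r N f -> Cmod u <= r -> Cmod (f u) <= N.
Proof.
  intros [a [Ha Hs]] Hu.
  apply (Csums_Cmod_le _ _ _ (Hs u Hu)); intros m.
  eapply Rle_trans; [apply Cmod_sum_n_le|].
  eapply Rle_trans; [|apply (Ha m)].
  apply sum_n_le_R; intros k; rewrite Cmod_mult, Cmod_pow.
  apply Rmult_le_compat_l; [apply Cmod_ge_0|].
  apply pow_incr; split; [apply Cmod_ge_0|exact Hu].
Qed.

Lemma expansion_shrink (r r' N : R) (f : C -> C) :
  0 <= r' <= r -> expansion r N f -> expansion r' N f.
Proof.
  intros Hr [a [Ha Hs]]; exists a; split.
  - intros m; eapply Rle_trans; [|apply (Ha m)].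
    apply sum_n_le_R; intros k.
    apply Rmult_le_compat_l; [apply Cmod_ge_0|apply pow_incr, Hr].
  - intros u Hu; apply Hs; lra.
Qed.

Lemma expansion_scal (r N : R) (f : C -> C) (c : C) :
  expansion r N f -> expansion r (Cmod c * N) (fun u => c * f u)%C.
Proof.
  intros [a [Ha Hs]]; exists (fun n => c * a n)%C; split.
  - intros m.
    rewrite (sum_n_ext _ (fun n => Cmod c * (Cmod (a n) * r ^ n)))
      by (intros n; rewrite Cmod_mult; eq_at_carrier; ring).
    rewrite sum_n_scal_R.
    apply Rmult_le_compat_l; [apply Cmod_ge_0|apply Ha].
  - intros u Hu.
    apply Csums_ext with (fun n => c * (a n * u ^ n))%C; [intros; ring|].
    now apply Csums_scal, Hs.
Qed.

Lemma expansion_plus (r M N : R) (f g : C -> C) :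
  0 <= r -> expansion r M f -> expansion r N g ->
  expansion r (M + N) (fun u => f u + g u)%C.
Proof.
  intros Hr [a [Ha Hs]] [b [Hb Ht]]; exists (fun n => a n + b n)%C; split.
  - intros m; apply Rle_trans with
      (sum_n (fun n => plus (Cmod (a n) * r ^ n) (Cmod (b n) * r ^ n)) m).
    + apply sum_n_le_R; intros k; change plus with Rplus; cbv beta.
      rewrite <- Rmult_plus_distr_r.
      apply Rmult_le_compat_r; [now apply pow_le|apply Cmod_triangle].
    + rewrite sum_n_plus; apply Rplus_le_compat; auto.
  - intros u Hu.
    apply Csums_ext with (fun n => a n * u ^ n + b n * u ^ n)%C; [intros; ring|].
    apply Csums_plus; auto.
Qed.

(** Multiplication by the variable shifts the coefficients by one place. *)
Lemma expansion_mul_var (r N : R) (f : C -> C) :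
  0 <= r -> expansion r N f -> expansion r (r * N) (fun u => u * f u)%C.
Proof.
  intros Hr [a [Ha Hs]].
  exists (fun n => match n with 0%nat => RtoC 0 | S m => a m end); split.
  - assert (H : forall m, sum_n (fun n =>
        Cmod match n with 0%nat => RtoC 0 | S m => a m end * r ^ n) (S m)
        = r * sum_n (fun n => Cmod (a n) * r ^ n) m).
    { induction m as [|m IH].
      - rewrite sum_n_S_R, !sum_O, Cmod_0; simpl; ring.
      - rewrite sum_n_S_R, IH, (sum_n_S_R _ m); simpl; ring. }
    intros [|m].
    + rewrite sum_O, Cmod_0, Rmult_0_l.
      apply Rmult_le_pos; [exact Hr|].
      eapply Rle_trans; [|apply (Ha 0%nat)].
      apply sum_n_ge0; intros k.
      apply Rmult_le_pos; [apply Cmod_ge_0|now apply pow_le].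
    + rewrite H; now apply Rmult_le_compat_l.
  - intros u Hu.
    apply Csums_ext with
      (fun n => match n with 0%nat => RtoC 0 | S m => u * (a m * u ^ m) end)%C.
    + intros [|n]; simpl; ring.
    + apply (Csums_shift (fun m => u * (a m * u ^ m))%C), Csums_scal, Hs, Hu.
Qed.

Lemma expansion_const (r : R) (c : C) : expansion r (Cmod c) (fun _ => c).
Proof.
  exists (fun n => match n with 0%nat => c | S _ => 0 end); split.
  - intros m; right; induction m as [|m IH].
    + rewrite sum_O; simpl; ring.
    + rewrite sum_n_S_R, IH, Cmod_0; ring.
  - intros u _.
    apply is_lim_seq_ext with (fun _ => 0); [|apply is_lim_seq_const].
    intros n; replace (sum_n _ n) with c.
    + replace (c - c)%C with (RtoC 0) by ring; now rewrite Cmod_0.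
    + induction n as [|n IH].
      * rewrite sum_O; simpl; ring.
      * rewrite sum_n_S_C, <- IH; ring.
Qed.

(** Completeness of the weighted l1 space, together with continuity of
    evaluation: coefficients are summed column by column, and the resulting
    power series is evaluated by exchanging the two summations. *)
Lemma expansion_series (r : R) (N : nat -> R) (f : nat -> C -> C) (F : C -> C) :
  0 < r -> ex_series N -> (forall k, expansion r (N k) (f k)) ->
  (forall u, Cmod u <= r -> Csums (fun k => f k u) (F u)) ->
  expansion r (Series N) F.
Proof.
  intros Hr HN Hf HF.
  (* A simultaneous choice of coefficient sequences for all the f k. *)
  pose (d := fun k => proj1_sig (constructive_indefinite_description _ (Hf k))).
  assert (Hd : forall k m, sum_n (fun n => Cmod (d k n) * r ^ n) m <= N k)
    by (intros k; apply (proj1 (proj2_sig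
          (constructive_indefinite_description _ (Hf k))))).
  assert (Hs : forall k u, Cmod u <= r -> Csums (fun n => d k n * u ^ n)%C (f k u))
    by (intros k; apply (proj2 (proj2_sig
          (constructive_indefinite_description _ (Hf k))))).
  clearbody d.
  assert (Hpos : forall k n, 0 <= Cmod (d k n) * r ^ n)
    by (intros; apply Rmult_le_pos; [apply Cmod_ge_0|apply pow_le; lra]).
  assert (HN0 : forall k, 0 <= N k).
  { intros k; eapply Rle_trans; [|apply (Hd k 0%nat)].
    rewrite sum_O; apply (Hpos k 0%nat). }
  (* Column n converges because r^n |d k n| is at most N k. *)
  assert (Hcol : forall n, exists b, Csums (fun k => d k n) b).
  { intros n; apply Csums_abs with (/ r ^ n * Series N); intros K.
    eapply Rle_trans; [|apply Rmult_le_compat_l;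
      [left; apply Rinv_0_lt_compat, pow_lt, Hr
      |apply (sum_n_le_Series N K HN0 HN)]].
    rewrite <- sum_n_scal_R; apply sum_n_le_R; intros k.
    apply Rmult_le_reg_r with (r ^ n); [now apply pow_lt|].
    apply Rle_trans with (N k).
    - eapply Rle_trans; [|apply (Hd k n)].
      apply (sum_n_term_le (fun n => Cmod (d k n) * r ^ n) n), Hpos.
    - right; field; apply pow_nonzero; lra. }
  pose (b := fun n => proj1_sig (constructive_indefinite_description _ (Hcol n))).
  assert (Hb : forall n, Csums (fun k => d k n) (b n))
    by (intros n; apply (proj2_sig (constructive_indefinite_description _ (Hcol n)))).
  clearbody b; exists b; split.
  - intros m.
    (* The norm of the K-th partial column sums is at most Series N; let K go to
       infinity in the finitely many columns n <= m. *)
    assert (Hlim : is_lim_seq (fun K =>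
        Series N + sum_n (fun n => Cmod (sum_n (fun k => d k n) K - b n) * r ^ n) m)
        (Series N + 0)).
    { apply is_lim_seq_plus'; [apply is_lim_seq_const|].
      assert (Hterm : forall n, is_lim_seq
          (fun K => Cmod (sum_n (fun k => d k n) K - b n) * r ^ n) 0).
      { intros n; replace (Finite 0) with (Rbar_mult 0 (r ^ n))
          by (simpl; f_equal; ring).
        apply is_lim_seq_scal_r, Hb. }
      induction m as [|m IH].
      - eapply is_lim_seq_ext; [|apply (Hterm 0%nat)].
        intros K; now rewrite sum_O.
      - apply is_lim_seq_ext with (fun K =>
          sum_n (fun n => Cmod (sum_n (fun k => d k n) K - b n) * r ^ n) m
          + Cmod (sum_n (fun k => d k (S m)) K - b (S m)) * r ^ S m).
        { intros K; now rewrite sum_n_S_R. }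
        replace (Finite 0) with (Finite (0 + 0)) by (f_equal; ring).
        apply is_lim_seq_plus'; [exact IH|apply Hterm]. }
    rewrite Rplus_0_r in Hlim.
    refine (is_lim_seq_le _ _ (sum_n (fun n => Cmod (b n) * r ^ n) m) (Series N)
              _ (is_lim_seq_const _) Hlim).
    intros K.
    apply Rle_trans with
      (sum_n (fun k => sum_n (fun n => Cmod (d k n) * r ^ n) m) K
       + sum_n (fun n => Cmod (sum_n (fun k => d k n) K - b n) * r ^ n) m).
    + rewrite (sum_n_switch (fun k n => Cmod (d k n) * r ^ n)).
      change Rplus with (@plus R_AbelianMonoid); rewrite <- sum_n_plus.
      change (@plus R_AbelianMonoid) with Rplus.
      apply sum_n_le_R; intros n.
      rewrite (sum_n_ext _ (fun k => r ^ n * Cmod (d k n)))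
        by (intros; apply Rmult_comm).
      rewrite sum_n_scal_R, (Rmult_comm (r ^ n)), <- Rmult_plus_distr_r.
      apply Rmult_le_compat_r; [apply pow_le; lra|].
      replace (b n) with (sum_n (fun k => d k n) K
                          + - (sum_n (fun k => d k n) K - b n))%C at 1 by ring.
      eapply Rle_trans; [apply Cmod_triangle|]; rewrite Cmod_opp.
      apply Rplus_le_compat_r, Cmod_sum_n_le.
    + apply Rplus_le_compat_r.
      eapply Rle_trans; [|apply (sum_n_le_Series N K HN0 HN)].
      apply sum_n_le_R; intros k; apply Hd.
  - intros u Hu.
    apply Csums_exchange with (fun k n => d k n * u ^ n)%C N (fun k => f k u); auto.
    + intros k m; eapply Rle_trans; [|apply (Hd k m)].
      apply sum_n_le_R; intros n; rewrite Cmod_mult, Cmod_pow.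
      apply Rmult_le_compat_l; [apply Cmod_ge_0|].
      apply pow_incr; split; [apply Cmod_ge_0|exact Hu].
    + intros n; rewrite Cmult_comm.
      apply Csums_ext with (fun k => u ^ n * d k n)%C; [intros; ring|].
      apply Csums_scal, Hb.
Qed.

Lemma expansion_mul_pow (r N : R) (f : C -> C) (k : nat) :
  0 <= r -> expansion r N f -> expansion r (r ^ k * N) (fun u => u ^ k * f u)%C.
Proof.
  intros Hr Hf; induction k as [|k IH].
  - simpl; rewrite Rmult_1_l; apply expansion_ext with f; [intros; ring|exact Hf].
  - simpl; rewrite Rmult_assoc.
    apply expansion_ext with (fun u => u * (u ^ k * f u))%C; [intros; ring|].
    now apply expansion_mul_var.
Qed.

Lemma expansion_weaken (r M N : R) (f : C -> C) :
  M <= N -> expansion r M f -> expansion r N f.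
Proof.
  intros H [a [Ha Hs]]; exists a; split; [|exact Hs].
  intros m; specialize (Ha m); lra.
Qed.

(** The product is the sum over [k] of [a k * u ^ k * g u], each term being a
    shifted and scaled copy of [g]; the norms add up to at most [M * N]. *)
Lemma expansion_mult (r M N : R) (f g : C -> C) :
  0 < r -> expansion r M f -> expansion r N g ->
  expansion r (M * N) (fun u => f u * g u)%C.
Proof.
  intros Hr [a [Ha Hs]] Hg.
  assert (HN : 0 <= N).
  { eapply Rle_trans; [apply Cmod_ge_0|apply (expansion_bound r N g 0 Hg)].
    rewrite Cmod_0; lra. }
  destruct (nonneg_series_bounded (fun n => Cmod (a n) * r ^ n) M) as [Hex Hle];
    [intros; apply Rmult_le_pos; [apply Cmod_ge_0|apply pow_le; lra]|exact Ha|].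
  apply expansion_weaken with (Series (fun n => Cmod (a n) * r ^ n * N)).
  { rewrite Series_scal_r; now apply Rmult_le_compat_r. }
  apply expansion_series with (fun k u => a k * (u ^ k * g u))%C; auto.
  - now apply ex_series_scal_r.
  - intros k; rewrite Rmult_assoc.
    apply expansion_scal, expansion_mul_pow; [lra|exact Hg].
  - intros u Hu; rewrite Cmult_comm.
    apply Csums_ext with (fun k => g u * (a k * u ^ k))%C; [intros; ring|].
    apply Csums_scal, Hs, Hu.
Qed.

Lemma expansion_pow (r N : R) (f : C -> C) (k : nat) :
  0 < r -> expansion r N f -> expansion r (N ^ k) (fun u => f u ^ k)%C.
Proof.
  intros Hr Hf; induction k as [|k IH]; simpl.
  - apply expansion_weaken with (Cmod 1); [right; apply Cmod_1|apply expansion_const].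
  - now apply expansion_mult.
Qed.

(** Substitution: [Phi (h u)] is the series of the functions [c k * h u ^ k],
    whose norms are dominated by the convergent series of [Cmod (c k) * N ^ k]. *)
Lemma expansion_compose (r N : R) (h : C -> C) (c : nat -> C) (Phi : C -> C) :
  0 < r -> ex_series (fun k => Cmod (c k) * N ^ k) ->
  (forall y, Cmod y <= N -> Csums (fun k => c k * y ^ k)%C (Phi y)) ->
  expansion r N h ->
  expansion r (Series (fun k => Cmod (c k) * N ^ k)) (fun u => Phi (h u)).
Proof.
  intros Hr Hc HPhi Hh.
  apply expansion_series with (fun k u => c k * h u ^ k)%C; auto.
  - intros k; now apply expansion_scal, expansion_pow.
  - intros u Hu; apply HPhi, (expansion_bound r N h u Hh Hu).
Qed.

(** Without constant term, the norm of every monomial is multiplied by at most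
    [r' / r] when the radius shrinks.  This brings the argument of an outer
    power series into its disc of convergence. *)
Lemma expansion_shrink_vanishing (r r' N : R) (h : C -> C) :
  0 < r' <= r -> h 0 = 0 -> expansion r N h -> expansion r' (r' / r * N) h.
Proof.
  intros Hr H0 [a [Ha Hs]].
  (* The constant coefficient is the value at 0: evaluate the series there. *)
  assert (Ha0 : a 0%nat = 0).
  { assert (H : is_lim_seq (fun _ => Cmod (a 0%nat)) 0).
    { assert (H := Hs 0); rewrite H0, Cmod_0 in H; specialize (H ltac:(lra)).
      eapply is_lim_seq_ext; [|exact H].
      intros n; cbv beta; f_equal; induction n as [|n IH].
      - rewrite sum_O; simpl; ring.
      - rewrite sum_n_S_C.
        replace (sum_n (fun n => a n * 0 ^ n)%C n + a (S n) * 0 ^ S n - 0)%C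
          with (sum_n (fun n => a n * 0 ^ n)%C n - 0)%C; [exact IH|].
        simpl; ring. }
    apply Cmod_eq_0.
    assert (Hu := is_lim_seq_unique _ _ H); rewrite Lim_seq_const in Hu.
    now injection Hu. }
  exists a; split; [|intros u Hu; apply Hs; lra].
  intros m.
  apply Rle_trans with (r' / r * sum_n (fun n => Cmod (a n) * r ^ n) m).
  - rewrite <- sum_n_scal_R; apply sum_n_le_R; intros [|n].
    + rewrite Ha0, Cmod_0; right; ring.
    + apply Rle_trans with (Cmod (a (S n)) * (r' * r ^ n)).
      * apply Rmult_le_compat_l; [apply Cmod_ge_0|].
        apply Rmult_le_compat_l; [lra|apply pow_incr; lra].
      * right; simpl; field; lra.
  - apply Rmult_le_compat_l; [|apply Ha].
    apply Rlt_le, Rdiv_lt_0_compat; lra.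
Qed.

Lemma expansion_analytic_at (f : C -> C) (z0 : C) (r N : R) :
  0 < r -> expansion r N (fun u => f (z0 + u)%C) -> analytic_at f z0.
Proof.
  intros Hr [a [Ha Hs]]; exists a, r; split; [exact Hr|].
  intros z Hz.
  specialize (Hs (z - z0)%C ltac:(lra)).
  replace (z0 + (z - z0))%C with z in Hs by ring.
  unfold is_pseries, is_series.
  apply (proj2 (filterlim_locally_ball_norm _ _)); intros eps.
  apply is_lim_seq_spec in Hs; destruct (Hs eps) as [n0 Hn0].
  exists n0; intros n Hn; specialize (Hn0 n Hn).
  rewrite Rminus_0_r, Rabs_pos_eq in Hn0 by apply Cmod_ge_0.
  unfold ball_norm.
  match goal with |- norm (minus ?x _) < _ =>
    replace x with (sum_n (fun n => a n * (z - z0) ^ n)%C n) end; [exact Hn0|].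
  apply sum_n_ext; intros k.
  change (a k * (z - z0) ^ k = pow_n (K := C_Ring) (z - z0) k * a k)%C.
  rewrite Cmult_comm; f_equal.
Qed.

(** * Principal logarithm and power *)

Lemma Cexp_plus (z w : C) : Cexp (z + w)%C = (Cexp z * Cexp w)%C.
Proof.
  destruct z as [x y], w as [x' y']; unfold Cexp, Cmult; simpl.
  rewrite exp_plus, cos_plus, sin_plus; f_equal; ring.
Qed.

Lemma Cmod_Cexp (z : C) : Cmod (Cexp z) = exp (Re z).
Proof.
  unfold Cexp, Cmod; simpl.
  transitivity (sqrt (exp (Re z))²); [f_equal|apply sqrt_Rsqr; left; apply exp_pos].
  generalize (sin2_cos2 (Im z)); unfold Rsqr; intros H.
  transitivity (exp (Re z) * exp (Re z) *
    (sin (Im z) * sin (Im z) + cos (Im z) * cos (Im z))); [ring|].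
  rewrite H; ring.
Qed.

(** With [Re z / Cmod z] the cosine of the argument, this is the absolute value
    of its sine; it serves to evaluate [sin] and [tan] at an [acos]. *)
Lemma sqrt_1_sub_cos_sqr (z : C) :
  z <> 0 -> sqrt (1 - (Re z / Cmod z)²) = Rabs (Im z) / Cmod z.
Proof.
  intros Hz; assert (Hr := proj1 (Cmod_gt_0 z) Hz); assert (Hm := Cmod2_alt z).
  set (r := Cmod z) in *.
  rewrite <- (sqrt_Rsqr (Rabs (Im z) / r)).
  - f_equal; rewrite !Rsqr_div', <- Rsqr_abs; unfold Rsqr.
    apply Rmult_eq_reg_r with (r * r); [|nra]; field_simplify; nra.
  - apply Rmult_le_pos; [apply Rabs_pos|left; now apply Rinv_0_lt_compat].
Qed.

Lemma Cexp_Clog (z : C) : z <> 0 -> Cexp (Clog z) = z.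
Proof.
  intros Hz; assert (Hr := proj1 (Cmod_gt_0 z) Hz).
  assert (Hre := re_le_Cmod z).
  set (r := Cmod z) in *.
  assert (Hq : -1 <= Re z / r <= 1).
  { apply Rabs_le_between in Hre; split.
    - apply Rmult_le_reg_r with r; [exact Hr|]; field_simplify; lra.
    - apply Rmult_le_reg_r with r; [exact Hr|]; field_simplify; lra. }
  assert (Hs := sqrt_1_sub_cos_sqr z Hz); fold r in Hs.
  unfold Cexp, Clog, Carg; simpl; fold r; rewrite exp_ln by exact Hr.
  destruct z as [x y]; simpl in *; f_equal.
  - destruct (Rle_dec 0 y); [|rewrite cos_neg]; rewrite cos_acos by exact Hq;
      field; lra.
  - destruct (Rle_dec 0 y); [|rewrite sin_neg]; rewrite sin_acos, Hs by exact Hq.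
    + rewrite Rabs_pos_eq by lra; field; lra.
    + rewrite Rabs_left by lra; field; lra.
Qed.

Lemma Cpower_nonzero (z a : C) : z <> 0 -> Cpower z a = Cexp (a * Clog z)%C.
Proof.
  intros Hz; unfold Cpower; destruct (Ceq_dec z 0) as [E|_]; [tauto|reflexivity].
Qed.

Lemma Cpower_sub_1 (z a : C) :
  z <> 0 -> Cpower z (a - 1)%C = (Cpower z a / z)%C.
Proof.
  intros Hz; rewrite !Cpower_nonzero by exact Hz.
  replace (a * Clog z)%C with ((a - 1) * Clog z + Clog z)%C by ring.
  rewrite Cexp_plus, Cexp_Clog by exact Hz; field; exact Hz.
Qed.

Lemma Cmod_Cpower (z : C) (a : R) :
  z <> 0 -> Cmod (Cpower z a) = exp (a * ln (Cmod z)).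
Proof.
  intros Hz; rewrite Cpower_nonzero by exact Hz.
  rewrite Cmod_Cexp; f_equal; unfold Clog; simpl; ring.
Qed.

(** Multiplication by a positive real rescales the modulus and leaves the
    principal argument unchanged, so the branch cut does not interfere. *)
Lemma Clog_pos_mult (c : R) (z : C) :
  0 < c -> z <> 0 -> Clog (c * z)%C = (ln c + Clog z)%C.
Proof.
  intros Hc Hz; assert (Hr := proj1 (Cmod_gt_0 z) Hz).
  unfold Clog, Carg; rewrite Cmod_mult, Cmod_R, Rabs_pos_eq by lra.
  rewrite re_scal_l, im_scal_l, ln_mult by assumption.
  replace (c * Re z / (c * Cmod z)) with (Re z / Cmod z) by (field; lra).
  unfold Cplus, RtoC; simpl; f_equal; rewrite Rplus_0_l.
  destruct (Rle_dec 0 (c * Im z)), (Rle_dec 0 (Im z)); try reflexivity; nra.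
Qed.

Lemma RtoC_neq_0 (c : R) : c <> 0 -> RtoC c <> 0.
Proof. intros H E; apply H; now injection E. Qed.

Lemma Clog_pos (x : R) : 0 < x -> Clog x = ln x.
Proof.
  intros Hx; unfold Clog, Carg; rewrite Cmod_R, Rabs_pos_eq by lra; simpl.
  destruct (Rle_dec 0 0) as [_|H]; [|lra].
  replace (x / x) with 1 by (field; lra); rewrite acos_1; reflexivity.
Qed.

Lemma Cpower_pos (x a : R) : 0 < x -> Cpower x a = exp (a * ln x).
Proof.
  intros Hx; rewrite Cpower_nonzero by (apply RtoC_neq_0; lra).
  rewrite Clog_pos, <- RtoC_mult by exact Hx.
  unfold Cexp; simpl; rewrite cos_0, sin_0; unfold RtoC; f_equal; ring.
Qed.

Lemma Cpower_pos_mult (c : R) (z a : C) :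
  0 < c -> Cpower (c * z)%C a = (Cpower c a * Cpower z a)%C.
Proof.
  intros Hc.
  assert (HcC : RtoC c <> 0) by (apply RtoC_neq_0; lra).
  destruct (Ceq_dec z 0) as [->|Hz].
  - rewrite Cmult_0_r; unfold Cpower at 1 3.
    destruct (Ceq_dec 0 0) as [_|H]; [|now destruct H].
    destruct (Ceq_dec a 0) as [->|_]; [|ring].
    rewrite Cpower_pos, Rmult_0_l, exp_0 by exact Hc; ring.
  - rewrite !Cpower_nonzero by (try apply Cmult_neq_0; assumption).
    rewrite Clog_pos_mult, Clog_pos by assumption.
    rewrite <- Cexp_plus; f_equal; ring.
Qed.

Lemma Carg_right_half (z : C) : 0 < Re z -> Carg z = atan (Im z / Re z).
Proof.
  intros Hx; assert (Hz : z <> 0) by (intros ->; simpl in Hx; lra).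
  assert (Hr := proj1 (Cmod_gt_0 z) Hz).
  unfold Carg; set (r := Cmod z) in *.
  rewrite acos_atan by now apply Rdiv_lt_0_compat.
  assert (Hs := sqrt_1_sub_cos_sqr z Hz); fold r in Hs.
  rewrite Hs; destruct (Rle_dec 0 (Im z)).
  - rewrite Rabs_pos_eq by lra; f_equal; field; lra.
  - rewrite Rabs_left, <- atan_opp by lra; f_equal; field; lra.
Qed.

(** On the right half plane the argument is [atan (Im z / Re z)], which gives a
    differentiable closed form in the two coordinates. *)
Lemma Cpower_right_half (z : C) (a : R) :
  0 < Re z ->
  Cpower z a =
    (exp (a * (ln (Re z ^ 2 + Im z ^ 2) / 2)) * cos (a * atan (Im z / Re z)),
     exp (a * (ln (Re z ^ 2 + Im z ^ 2) / 2)) * sin (a * atan (Im z / Re z))).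
Proof.
  intros Hx; assert (Hz : z <> 0) by (intros ->; simpl in Hx; lra).
  rewrite Cpower_nonzero by exact Hz.
  assert (Hl : ln (Cmod z) = ln (Re z ^ 2 + Im z ^ 2) / 2).
  { rewrite <- Cmod2_alt; simpl.
    assert (Hr := proj1 (Cmod_gt_0 z) Hz).
    rewrite Rmult_1_r, ln_mult by exact Hr; field. }
  unfold Clog; rewrite Hl, Carg_right_half by exact Hx.
  unfold Cexp; simpl.
  f_equal; f_equal; f_equal; ring.
Qed.

(** The multiplier [c] lets one real-valued statement treat both the real and
    the imaginary part, and absorbs the constants when derivatives are iterated. *)
Lemma is_derive_Re_Cpower_line (c u : C) (a t : R) :
  0 < Re (1 + t * u) ->
  is_derive (fun s : R => Re (c * Cpower (1 + s * u) a)) t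
    (Re (c * a * u * Cpower (1 + t * u) (a - 1)%R)).
Proof.
  intros Ht; assert (Hz : (1 + t * u)%C <> 0) by (intros E; rewrite E in Ht; simpl in Ht; lra).
  destruct c as [c1 c2], u as [p q].
  assert (Hre : forall s : R, Re (1 + s * (p, q)) = 1 + s * p) by (intros; simpl; ring).
  assert (Him : forall s : R, Im (1 + s * (p, q)) = s * q) by (intros; simpl; ring).
  rewrite Hre in Ht.
  rewrite RtoC_minus, Cpower_sub_1 by exact Hz.
  rewrite Cpower_right_half by (rewrite Hre; exact Ht).
  apply is_derive_ext_loc with (fun s =>
    exp (a * (ln ((1 + s * p) ^ 2 + (s * q) ^ 2) / 2)) *
    (c1 * cos (a * atan (s * q / (1 + s * p)))
     - c2 * sin (a * atan (s * q / (1 + s * p))))).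
  - assert (Hloc : locally t (fun s => 0 < 1 + s * p)).
    { assert (Hc : continuous (fun s : R => 1 + s * p) t)
        by (apply (ex_derive_continuous (V := R_NormedModule)); auto_derive; trivial).
      exact (Hc _ (open_gt 0 _ Ht)). }
    apply (filter_imp (fun s => 0 < 1 + s * p)); [|exact Hloc].
    intros s Hs; rewrite Cpower_right_half, Hre, Him by (rewrite Hre; exact Hs).
    simpl; ring.
  - rewrite Hre, Him.
    assert (Hn : 0 < (1 + t * p) ^ 2 + (t * q) ^ 2) by nra.
    auto_derive.
    + repeat split; try lra; simpl in Hn; lra.
    + set (E := exp _).
      replace (exp (a * (ln ((1 + t * p) * ((1 + t * p) * 1) + t * q * (t * q * 1)) * / 2))) with E
        by (unfold E; f_equal; simpl; unfold Rdiv; ring).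
      unfold Rdiv. set (K := cos _). set (S := sin _). simpl.
      field; simpl in Hn; nra.
Qed.

(** * The binomial series of the principal power *)

Fixpoint falling (a : R) (k : nat) : R :=
  match k with 0%nat => 1 | S k => falling a k * (a - INR k) end.

Definition binom (a : R) (k : nat) : R := falling a k / INR (fact k).

(** Each new factor [(a - k) / (k + 1)] has absolute value at most 1. *)
Lemma Rabs_binom_le_1 (a : R) (k : nat) : -1 <= a <= 1 -> Rabs (binom a k) <= 1.
Proof.
  intros Ha; induction k as [|k IH]; unfold binom in *.
  - simpl; rewrite Rdiv_1_r, Rabs_R1; lra.
  - change (falling a (S k)) with (falling a k * (a - INR k)).
    change (fact (S k)) with (S k * fact k)%nat; rewrite mult_INR.
    assert (Hf := INR_fact_neq_0 k); assert (Hk := pos_INR k).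
    assert (HS : INR (S k) = INR k + 1) by apply S_INR.
    replace (falling a k * (a - INR k) / (INR (S k) * INR (fact k)))
      with ((falling a k / INR (fact k)) * ((a - INR k) / INR (S k)))
      by (field; lra).
    rewrite Rabs_mult, <- (Rmult_1_r 1).
    apply Rmult_le_compat; try apply Rabs_pos; [exact IH|].
    apply Rabs_le; split; apply Rmult_le_reg_r with (INR (S k)); try lra;
      field_simplify; lra.
Qed.

Lemma Re_1_plus_line_pos (u : C) (t : R) :
  Cmod u <= / 4 -> Rabs t < 2 -> 0 < Re (1 + t * u).
Proof.
  intros Hu Ht.
  assert (H : Rabs (t * Re u) <= 2 * / 4).
  { rewrite Rabs_mult; apply Rmult_le_compat; try apply Rabs_pos; [lra|].
    eapply Rle_trans; [apply re_le_Cmod|exact Hu]. }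
  apply Rabs_le_between in H; rewrite re_plus, re_scal_l; simpl; lra.
Qed.

(** The range [Rabs t < 2] is an open neighbourhood of the segment [0, 1], as
    iterated derivatives require, on which [1 + t * u] stays in the right half
    plane. *)
Lemma Derive_n_Re_Cpower_line (c u : C) (a : R) (k : nat) (t : R) :
  Cmod u <= / 4 -> Rabs t < 2 ->
  let f := fun s : R => Re (c * Cpower (1 + s * u) a) in
  ex_derive_n f k t /\
  Derive_n f k t
    = Re (c * falling a k * u ^ k * Cpower (1 + t * u) (a - INR k)%R).
Proof.
  intros Hu Ht f.
  assert (Hder : forall k t, Rabs t < 2 ->
    is_derive (fun s : R =>
        Re (c * falling a k * u ^ k * Cpower (1 + s * u) (a - INR k)%R)) t
      (Re (c * falling a (S k) * u ^ S k * Cpower (1 + t * u) (a - INR (S k))%R))).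
  { clear k t Ht; intros k t Ht.
    assert (H := is_derive_Re_Cpower_line (c * falling a k * u ^ k) u (a - INR k) t
                   (Re_1_plus_line_pos u t Hu Ht)).
    replace (a - INR k - 1) with (a - INR (S k)) in H by (rewrite S_INR; ring).
    replace (c * falling a (S k) * u ^ S k)%C
      with (c * falling a k * u ^ k * (a - INR k)%R * u)%C; [exact H|].
    rewrite Cpow_S; simpl falling; rewrite RtoC_mult; ring. }
  assert (Hloc : forall t, Rabs t < 2 -> locally t (fun s => Rabs s < 2)).
  { intros s Hs; apply (continuous_Rabs s (fun y => y < 2)).
    exact (open_lt 2 _ Hs). }
  revert t Ht; induction k as [|k IH]; intros t Ht.
  - split; [exact I|].
    change (f t = Re (c * 1 * 1 * Cpower (1 + t * u) (a - 0)%R)).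
    rewrite Rminus_0_r; unfold f; f_equal; ring.
  - assert (H : is_derive (Derive_n f k) t
      (Re (c * falling a (S k) * u ^ S k * Cpower (1 + t * u) (a - INR (S k))%R))).
    { eapply is_derive_ext_loc; [|apply (Hder k t Ht)].
      apply (filter_imp (fun s => Rabs s < 2)); [|apply Hloc, Ht].
      intros s Hs; symmetry; apply IH, Hs. }
    split; [eexists; exact H|exact (is_derive_unique _ _ _ H)].
Qed.

Lemma Cmod_1_plus_ge (u : C) (t : R) :
  Cmod u <= / 4 -> 0 <= t <= 1 -> 3 / 4 <= Cmod (1 + t * u).
Proof.
  intros Hu Ht.
  assert (H := Cmod_triangle (1 + t * u) (- (t * u))).
  replace (1 + t * u + - (t * u))%C with (RtoC 1) in H by ring.
  rewrite Cmod_1, Cmod_opp, Cmod_mult, Cmod_R, Rabs_pos_eq in H by lra.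
  generalize (Cmod_ge_0 u); nra.
Qed.

(** The base has modulus at least 3/4 and the exponent lies between [- (n + 2)]
    and 0. *)
Lemma Cmod_Cpower_line_le (u : C) (a t : R) (n : nat) :
  -1 <= a <= 1 -> Cmod u <= / 4 -> 0 <= t <= 1 ->
  Cmod (Cpower (1 + t * u) (a - INR (S n))%R) <= (4 / 3) ^ (S (S n)).
Proof.
  intros Ha Hu Ht; assert (Hm := Cmod_1_plus_ge u t Hu Ht).
  assert (Hz : (1 + t * u)%C <> 0) by (apply Cmod_gt_0; lra).
  rewrite Cmod_Cpower by exact Hz.
  rewrite <- (Rpower_pow _ (4 / 3)) by lra; unfold Rpower.
  assert (Hl : - ln (4 / 3) <= ln (Cmod (1 + t * u))).
  { rewrite <- ln_Rinv by lra; apply ln_le; [|replace (/ (4 / 3)) with (3 / 4) by field]; lra. }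
  assert (H0 : 0 <= ln (4 / 3)) by (rewrite <- ln_1; apply ln_le; lra).
  assert (Hn := pos_INR n).
  assert (Hexp : (a - INR (S n)) * ln (Cmod (1 + t * u)) <= INR (S (S n)) * ln (4 / 3)).
  { rewrite !S_INR; nra. }
  destruct Hexp as [Hlt| ->]; [left; now apply exp_increasing|right; reflexivity].
Qed.

Lemma Re_sum_n (s : nat -> C) (n : nat) :
  Re (sum_n s n) = sum_n (fun k => Re (s k)) n.
Proof.
  induction n as [|n IH]; [now rewrite !sum_O|].
  rewrite sum_n_S_C, sum_n_S_R, re_plus, IH; reflexivity.
Qed.

(** Taylor's formula with Lagrange remainder for the real function
    [t => Re (c * (1 + t u) ^ a)] on [0, 1].  The remainder is at most
    [Cmod c * (1/4)^(n+1) * (4/3)^(n+2)]. *)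
Lemma Re_binomial_remainder (c u : C) (a : R) (n : nat) :
  -1 <= a <= 1 -> Cmod u <= / 4 ->
  Rabs (Re (c * (Cpower (1 + u) a - sum_n (fun k => binom a k * u ^ k)%C n)))
  <= Cmod c * (4 / 3 * (/ 3) ^ S n).
Proof.
  intros Ha Hu.
  pose (f := fun s : R => Re (c * Cpower (1 + s * u) a)).
  destruct (Taylor_Lagrange f n 0 1) as [xi [Hxi HT]]; [lra| |].
  { intros t Ht k _; apply Derive_n_Re_Cpower_line; [exact Hu|].
    rewrite Rabs_pos_eq; lra. }
  assert (Hsum : sum_f_R0 (fun m => (1 - 0) ^ m / INR (fact m) * Derive_n f m 0) n
                 = Re (c * sum_n (fun k => binom a k * u ^ k)%C n)).
  { rewrite <- sum_n_scal_C, Re_sum_n, <- sum_n_Reals.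
    apply sum_n_ext; intros m.
    assert (HD := proj2 (Derive_n_Re_Cpower_line c u a m 0 Hu
                           ltac:(rewrite Rabs_R0; lra))).
    fold f in HD; rewrite HD.
    replace (1 + 0 * u)%C with (RtoC 1) by ring.
    rewrite Cpower_pos, ln_1, Rmult_0_r, exp_0 by lra.
    replace (c * falling a m * u ^ m * 1)%C with (falling a m * (c * u ^ m))%C by ring.
    replace (c * (binom a m * u ^ m))%C with (binom a m * (c * u ^ m))%C by ring.
    rewrite !re_scal_l; unfold binom.
    rewrite Rminus_0_r, pow1; eq_at_carrier; field; apply INR_fact_neq_0. }
  rewrite Hsum in HT; unfold f at 1 in HT.
  replace (1 + 1 * u)%C with (1 + u)%C in HT by ring.
  replace (Re (c * (Cpower (1 + u) a - sum_n (fun k => binom a k * u ^ k)%C n)))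
    with (Re (c * Cpower (1 + u) a) - Re (c * sum_n (fun k => binom a k * u ^ k)%C n))
    by (rewrite !re_mult; unfold Cminus; rewrite re_plus, re_opp, im_plus, im_opp; ring).
  rewrite HT.
  assert (HD := proj2 (Derive_n_Re_Cpower_line c u a (S n) xi Hu
                         ltac:(rewrite Rabs_pos_eq; lra))).
  fold f in HD; rewrite HD.
  set (P := Cpower (1 + xi * u) _).
  assert (HP : Cmod P <= (4 / 3) ^ S (S n))
    by (apply Cmod_Cpower_line_le; [exact Ha|exact Hu|lra]).
  replace (c * falling a (S n) * u ^ S n * P)%C
    with (falling a (S n) * (c * u ^ S n * P))%C by ring.
  rewrite re_scal_l.
  match goal with |- Rabs ?x <= _ =>
    replace x with (binom a (S n) * Re (c * u ^ S n * P))
      by (unfold binom; rewrite Rminus_0_r, pow1; field; apply INR_fact_neq_0) end.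
  rewrite Rabs_mult.
  apply Rle_trans with (1 * Cmod (c * u ^ S n * P)).
  { apply Rmult_le_compat; try apply Rabs_pos;
      [now apply Rabs_binom_le_1|apply re_le_Cmod]. }
  rewrite Rmult_1_l, !Cmod_mult, Cmod_pow, Rmult_assoc.
  apply Rmult_le_compat_l; [apply Cmod_ge_0|].
  apply Rle_trans with ((/ 4) ^ S n * (4 / 3) ^ S (S n)).
  { apply Rmult_le_compat; [apply pow_le, Cmod_ge_0|apply Cmod_ge_0| |exact HP].
    apply pow_incr; split; [apply Cmod_ge_0|exact Hu]. }
  right; change ((4 / 3) ^ S (S n)) with (4 / 3 * (4 / 3) ^ S n).
  replace (/ 3) with (/ 4 * (4 / 3)) by field.
  rewrite Rpow_mult_distr; ring.
Qed.

(** The binomial theorem for the principal power, on a disc small enough for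
    the Lagrange remainder to tend to 0. *)
Lemma binomial_series (u : C) (a : R) :
  -1 <= a <= 1 -> Cmod u <= / 4 ->
  Csums (fun k => binom a k * u ^ k)%C (Cpower (1 + u) a).
Proof.
  intros Ha Hu.
  apply is_lim_seq_squeeze0 with (fun n => 4 / 3 * (/ 3) ^ S n).
  - intros n; split; [apply Cmod_ge_0|].
    set (s := sum_n _ n).
    replace (s - Cpower (1 + u) a)%C with (- (Cpower (1 + u) a - s))%C by ring.
    rewrite Cmod_opp.
    (* With c the conjugate of the remainder d, Re (c * d) is the square of the
       modulus of d, so the bound on real parts bounds the modulus. *)
    assert (H := Re_binomial_remainder
      (Cconj (Cpower (1 + u) a - s)) u a n Ha Hu); fold s in H.
    set (d := (Cpower (1 + u) a - s)%C) in *.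
    rewrite Cmult_comm, <- Cmod2_conj, Cmod_conj, re_RtoC in H.
    rewrite Rabs_pos_eq in H by (apply pow_le, Cmod_ge_0).
    destruct (Cmod_ge_0 d) as [Hd|Hd].
    + apply Rmult_le_reg_l with (Cmod d); [exact Hd|]; simpl in H |- *; lra.
    + rewrite <- Hd; apply Rmult_le_pos; [lra|apply pow_le; lra].
  - replace (Finite 0) with (Rbar_mult (4 / 3) 0) by (simpl; f_equal; ring).
    apply is_lim_seq_scal_l.
    apply (is_lim_seq_incr_1 (fun n => (/ 3) ^ n)), is_lim_seq_geom.
    rewrite Rabs_pos_eq; lra.
Qed.

(** * Analyticity of principal powers with positive base value *)

(** Analyticity at 0, with the radius and the norm left unspecified. *)
Definition analytic_germ (f : C -> C) : Prop :=
  exists r N, 0 < r /\ expansion r N f.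

Lemma analytic_germ_affine (c d : C) (f : C -> C) :
  (forall u, f u = c + d * u)%C -> analytic_germ f.
Proof.
  intros Hf; exists 1, (Cmod c + Cmod d * (1 * Cmod 1)); split; [lra|].
  apply expansion_ext with (fun u => c + d * (u * 1))%C.
  { intros u _; rewrite Hf; ring. }
  apply expansion_plus; [lra|apply expansion_const|].
  apply expansion_scal, expansion_mul_var; [lra|apply expansion_const].
Qed.

Lemma analytic_germ_common (f g : C -> C) :
  analytic_germ f -> analytic_germ g ->
  exists r M N, 0 < r /\ expansion r M f /\ expansion r N g.
Proof.
  intros [r [M [Hr Hf]]] [r' [N [Hr' Hg]]].
  assert (H : 0 < Rmin r r') by now apply Rmin_pos.
  exists (Rmin r r'), M, N; split; [exact H|split].
  - apply expansion_shrink with r; [|exact Hf]; split; [lra|apply Rmin_l].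
  - apply expansion_shrink with r'; [|exact Hg]; split; [lra|apply Rmin_r].
Qed.

Lemma analytic_germ_mult (f g : C -> C) :
  analytic_germ f -> analytic_germ g -> analytic_germ (fun u => f u * g u)%C.
Proof.
  intros Hf Hg; destruct (analytic_germ_common f g Hf Hg) as (r & M & N & Hr & Hf' & Hg').
  exists r, (M * N); split; [exact Hr|now apply expansion_mult].
Qed.

Lemma analytic_germ_add_const (c : C) (f : C -> C) :
  analytic_germ f -> analytic_germ (fun u => c + f u)%C.
Proof.
  intros [r [N [Hr Hf]]]; exists r, (Cmod c + N); split; [exact Hr|].
  apply expansion_plus; [lra|apply expansion_const|exact Hf].
Qed.

(** Write [f = p (1 + h)] with [h] vanishing at 0.  The positive factor [p] comes
    out of the principal power, and after shrinking the radius until [h] has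
    norm 1/4 the binomial series can be composed with [h]. *)
Lemma analytic_germ_Cpower (f : C -> C) (p a : R) :
  0 < p -> -1 <= a <= 1 -> f 0 = p ->
  analytic_germ f -> analytic_germ (fun u => Cpower (f u) a).
Proof.
  intros Hp Ha Hf0 [r [N [Hr Hf]]].
  assert (HpC : RtoC p <> 0) by (apply RtoC_neq_0; lra).
  assert (HN : p <= N).
  { assert (H := expansion_bound r N f 0 Hf ltac:(rewrite Cmod_0; lra)).
    rewrite Hf0, Cmod_R, Rabs_pos_eq in H; lra. }
  pose (h := fun u => (-1 + / p * f u)%C).
  pose (M := Cmod (-1) + Cmod (/ p) * N).
  assert (Hh : expansion r M h).
  { apply expansion_plus; [lra|apply expansion_const|now apply expansion_scal]. }
  assert (Hh0 : h 0 = 0) by (unfold h; rewrite Hf0; field; exact HpC).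
  (* M counts the modulus 1 of the constant -1, which keeps r / (4 M) below r. *)
  assert (HM1 : 1 <= M).
  { unfold M; generalize (Cmod_ge_0 (/ p)); rewrite Cmod_R, Rabs_left by lra; nra. }
  pose (r' := r / (4 * M)).
  assert (Hr' : 0 < r' <= r).
  { unfold r'; split; [apply Rdiv_lt_0_compat; lra|].
    apply Rmult_le_reg_r with (4 * M); [lra|]; field_simplify; nra. }
  apply (expansion_shrink_vanishing r r' M h Hr' Hh0) in Hh.
  replace (r' / r * M) with (/ 4) in Hh by (unfold r'; field; lra).
  assert (Hc : ex_series (fun k => Cmod (binom a k) * (/ 4) ^ k)).
  { apply (ex_series_le (V := R_CompleteNormedModule) _ (fun k => (/ 4) ^ k));
      [|apply ex_series_geom; rewrite Rabs_pos_eq; lra].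
    intros k; change (norm ?x) with (Rabs x).
    rewrite Cmod_R, Rabs_mult, Rabs_Rabsolu, (Rabs_pos_eq ((/ 4) ^ k)) by (apply pow_le; lra).
    rewrite <- (Rmult_1_l ((/ 4) ^ k)) at 2.
    apply Rmult_le_compat_r; [apply pow_le; lra|now apply Rabs_binom_le_1]. }
  assert (H := expansion_compose r' (/ 4) h (fun k => RtoC (binom a k))
    (fun y => Cpower (1 + y) a) (proj1 Hr') Hc
    (fun y Hy => binomial_series y a Ha Hy) Hh).
  eexists r', _; split; [apply Hr'|].
  eapply expansion_ext; [|exact (expansion_scal _ _ _ (Cpower p a) H)].
  intros u _; cbv beta.
  rewrite <- Cpower_pos_mult by exact Hp.
  f_equal; unfold h; field; exact HpC.
Qed.

Lemma analytic_germ_at (f : C -> C) (z0 : C) :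
  analytic_germ (fun u => f (z0 + u)%C) -> analytic_at f z0.
Proof. intros (r & N & Hr & H); exact (expansion_analytic_at f z0 r N Hr H). Qed.

(** * The generating function *)

Lemma G_factor (alpha : R) (zeta : C) :
  0 < alpha < 1 ->
  G alpha zeta
  = (((2 - alpha) / (2 - 2 * alpha))%R * (1 - (alpha / (2 - alpha))%R * zeta))%C.
Proof.
  intros H; unfold G, gamma0, gamma1.
  destruct zeta as [x y].
  unfold Cminus, RtoC, Cplus, Cmult, Copp; simpl; f_equal; field; lra.
Qed.

Lemma factors_pos (alpha tau x : R) :
  0 < alpha < 1 -> 0 < tau -> x < 1 ->
  0 < (1 - x) / tau /\
  0 < (2 - alpha) / (2 - 2 * alpha) * (1 - alpha / (2 - alpha) * x).
Proof.
  intros Ha Ht Hx; split; [apply Rdiv_lt_0_compat; lra|].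
  apply Rmult_lt_0_compat; [apply Rdiv_lt_0_compat; lra|].
  apply Rmult_lt_reg_r with (2 - alpha); [lra|]; field_simplify; nra.
Qed.

Lemma affine_base_RtoC (tau x : R) :
  0 < tau -> ((1 - x) / tau)%C = RtoC ((1 - x) / tau).
Proof. intros H; rewrite RtoC_div, RtoC_minus by lra; reflexivity. Qed.

Lemma G_RtoC (alpha x : R) :
  0 < alpha < 1 ->
  G alpha x = RtoC ((2 - alpha) / (2 - 2 * alpha) * (1 - alpha / (2 - alpha) * x)).
Proof.
  intros H; rewrite G_factor by exact H.
  now rewrite RtoC_mult, RtoC_minus, (RtoC_mult _ x).
Qed.

Theorem lemma4p5 (alpha beta tau : R)
    (halpha : 0 < alpha < 1) (hbeta : 0 < beta < 1) (htau : 0 < tau) :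
  (forall zeta : C,
     w alpha beta tau zeta =
     Cpower (1 + Cpower ((1 - zeta) / tau) alpha
                 * Cpower ((2 - alpha) / (2 - 2 * alpha)) (1 - alpha)
                 * Cpower (1 - alpha / (2 - alpha) * zeta) (1 - alpha))%C
            (- beta)%C)
  /\ (forall x : R, x < 1 -> analytic_at (w alpha beta tau) x)
  /\ (forall x : R, x < 1 ->
        Im (w alpha beta tau x) = 0 /\ 0 <= Re (w alpha beta tau x)).
Proof.
  (* On the half line every base is a positive real, so every power is one too. *)
  assert (Hbase : forall x : R, x < 1 -> exists y : R, 0 < y /\
    (1 + Cpower ((1 - x) / tau) alpha * Cpower (G alpha x) (1 - alpha))%C = RtoC y).
  { intros x Hx; destruct (factors_pos alpha tau x halpha htau Hx) as [H1 H2].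
    rewrite affine_base_RtoC, G_RtoC, <- RtoC_minus by assumption.
    rewrite !Cpower_pos by assumption.
    eexists; split; [|rewrite <- RtoC_mult, <- RtoC_plus; reflexivity].
    apply Rplus_lt_0_compat; [lra|apply Rmult_lt_0_compat; apply exp_pos]. }
  split; [|split].
  - intros zeta; unfold w.
    rewrite G_factor by exact halpha.
    rewrite Cpower_pos_mult.
    + rewrite !RtoC_div, !RtoC_minus, RtoC_mult by lra.
      now rewrite Cmult_assoc.
    + apply Rdiv_lt_0_compat; lra.
  - intros x Hx; destruct (factors_pos alpha tau x halpha htau Hx) as [H1 H2].
    destruct (Hbase x Hx) as [y [Hy Hy']].
    apply analytic_germ_at; unfold w.
    rewrite <- RtoC_opp, <- (RtoC_minus 1 alpha) in *.
    apply analytic_germ_Cpower with y; [exact Hy|lra| |].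
    + rewrite Cplus_0_r; exact Hy'.
    + apply analytic_germ_add_const, analytic_germ_mult.
      * apply analytic_germ_Cpower with ((1 - x) / tau); [exact H1|lra| |].
        { rewrite Cplus_0_r; now apply affine_base_RtoC. }
        apply analytic_germ_affine with ((1 - x) / tau)%C (- / tau)%C; intros u.
        field; apply RtoC_neq_0; lra.
      * eapply analytic_germ_Cpower; [exact H2|lra| |].
        { rewrite Cplus_0_r; now apply G_RtoC. }
        apply analytic_germ_affine
          with (- gamma1 alpha * x - gamma0 alpha)%C (- gamma1 alpha)%C; intros u.
        unfold G; ring.
  - intros x Hx; destruct (Hbase x Hx) as [y [Hy Hy']].
    unfold w; rewrite Hy', <- RtoC_opp, Cpower_pos by exact Hy.
    rewrite im_RtoC, re_RtoC; split; [reflexivity|left; apply exp_pos].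
Qed.
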